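(* Let $G$ be a unicyclic graph with $n \ge 4$ vertices and maximum degree $\Delta \ge 3$, let $q=\lfloor \frac{n}{\Delta-1}\rfloor$, and let $f : [1,\infty) \to \mathbb{R}^+$ be a function such that $\log f$ is convex. If $q=1$ or $n=2\Delta-2$, then $$ II_f(G) \le f(\Delta)\, f(n-\Delta+1)\, f(2)\, f(1)^{n-3}. $$ If $q>1$ and $n\ne 2\Delta-2$, then $$ II_f(G) \le f(\Delta)^q\, f\big(n-q(\Delta-1)+1\big)\, f(1)^{n-q-1}. $$ Both inequalities are attained (i.e., equality holds in the respective case) if and only if $G \in \mathcal{K}_n^\Delta$.
   Context: All graphs are finite, connected, simple (no loops, no multiple edges) and have at least one edge. A unicyclic graph is a graph containing exactly one cycle. For a vertex $u$ of $G$, $d_u$ denotes its degree. $\mathbb{R}^+$ denotes the positive real numbers. For a function $f:[1,\infty)\to\mathbb{R}^+$, $II_f(G) = \prod_{u\in V(G)} f(d_u)$. For $n\ge 4$, $3\le\Delta\le n-1$ and $q=\lfloor \frac{n}{\Delta-1}\rfloor$, define the $n$-tuple $\mathbf{z}$ as follows. If $q=1$ or $n=2\Delta-2$, then $\mathbf{z}=(\Delta,\,n-\Delta+1,\,2,\,1,\dots,1)$ with $n-3$ entries equal to $1$ at the end. If $q\ge 2$ and $n\ne 2\Delta-2$, then $\mathbf{z}=(z_1,\dots,z_n)$ with $z_j=\Delta$ for $1\le j\le q$, $z_{q+1}=n-q(\Delta-1)+1$, and $z_j=1$ for $q+1<j\le n$. $\mathcal{K}_n^\Delta$ is the set of unicyclic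 graphs with $n$ vertices whose degree sequence (in non-increasing order) is $\mathbf{z}$.
   Formalization: The ''only if'' part of the equality clause is proved for log f strictly convex; for merely convex log f it fails (f = 1, n = 5, Δ = 3, triangle with a pendant path of length 2). The inequalities and the ''if'' part are proved for all convex log f. *)

(* Defs.v *)
From HB Require Import structures.
From mathcomp Require Import all_boot all_order all_algebra.
From mathcomp Require Import interval_inference.
From mathcomp Require Import boolp classical_sets set_interval reals.
From mathcomp Require Import topology normedtype exp convex.

Set Implicit Arguments.
Unset Strict Implicit.
Unset Printing Implicit Defensive.

Import Order.TTheory GRing.Theory Num.Theory.

Local Open Scope nat_scope.

Record graph (T : finType) := Graph {
  adj :> rel T;
  adj_sym : symmetric adj;
  adj_irrefl : irreflexive adj;
  adj_connected : forall u v : T, connect adj u v;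
  adj_edge : exists u v : T, adj u v }.

Section GraphNotions.
Variables (T : finType) (G : graph T).

Definition degree (u : T) : nat := #|[set v | G u v]|.

Definition max_degree : nat := \max_(u : T) degree u.

Definition degree_sequence : seq nat := sort geq [seq degree u | u <- enum T].

(* A cycle, as a subgraph, is identified with its edge set, so the rotations
   and the reversal of a cyclic vertex sequence give the same cycle, whereas
   distinct cycles on the same vertex set remain distinct. *)
Definition cycle_edges (c : seq T) : {set {set T}} :=
  [set [set x; next c x] | x in c].

Definition is_cycle (C : {set {set T}}) : Prop :=
  exists2 c : seq T, ucycle G c /\ 3 <= size c & C = cycle_edges c.

Definition unicyclic : Prop := exists! C : {set {set T}}, is_cycle C.

Definition II (R : realType) (f : R -> R) : R :=
  (\prod_(u : T) f (degree u)%:R)%R.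

End GraphNotions.

(* For 3 <= Delta < n every natural-number subtraction below is exact. *)
Definition zseq (n Delta : nat) : seq nat :=
  let q := n %/ (Delta - 1) in
  if (q == 1) || (n == 2 * Delta - 2)
  then [:: Delta, n - Delta + 1, 2 & nseq (n - 3) 1]
  else nseq q Delta ++ (n - q * (Delta - 1) + 1) :: nseq (n - q - 1) 1.

Definition in_K (n Delta : nat) (T : finType) (G : graph T) : Prop :=
  [/\ #|T| = n, unicyclic G & degree_sequence G = zseq n Delta].

Local Open Scope ring_scope.
Local Open Scope convex_scope.

(* Strict convexity is needed to characterise equality: for the log-convex
   function f = 1, every unicyclic graph attains the bounds. *)
Definition strictly_convex_function (R : numFieldType) (E : lmodType R)
    (E' := convex_lmodType E) (D : set E') (f : E' -> R^o) :=
  forall t : {i01 R}, 0 < t%:num < 1 ->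
    {in D &, forall x y : E', x != y -> f (x <| t |> y) < f x <| t |> f y}.

Definition log_convex (R : realType) (f : R -> R) : Prop :=
  @convex_function R R^o `[1, +oo[%classic (fun x : R => ln (f x)).

Definition strictly_log_convex (R : realType) (f : R -> R) : Prop :=
  @strictly_convex_function R R^o `[1, +oo[%classic (fun x : R => ln (f x)).

(* Main.v *)
(** The degrees of a unicyclic graph on [n] vertices sum to [2 n], because its
    edges are those of a breadth-first spanning tree and exactly one more; they
    lie in [1, Delta], and the vertices of the cycle have degree at least [2].
    A sequence with these properties is majorized by [zseq n Delta].  Here
    majorization means domination of all hinge sums [\sum_x (x - k)^+], and it
    suffices for the inequality because a convex function on the naturals is
    affine plus a combination of hinges weighted by its nonnegative second
    differences.  When these weights are positive, equality forces all hinge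
    sums to agree, and hinge sums determine a multiset of naturals. *)
Require Import Defs.
From HB Require Import structures.
From mathcomp Require Import all_boot all_order all_algebra.
From mathcomp Require Import interval_inference.
From mathcomp Require Import boolp classical_sets set_interval reals.
From mathcomp Require Import topology normedtype exp convex.
From mathcomp Require Import sequences.
From mathcomp Require Import zify ring lra.

Set Implicit Arguments.
Unset Strict Implicit.
Unset Printing Implicit Defensive.

Import Order.TTheory GRing.Theory Num.Theory.

Local Open Scope ring_scope.

(** * Degrees of a unicyclic graph *)

Section UnicyclicDegrees.
Local Open Scope nat_scope.

(** With [x] rotated to the front, [c] reads [x :: y :: z :: s]: the successor is [y], the
    predecessor is the last entry of [z :: s], and [uniq] separates them. *)
Lemma next_neq_prev (T : eqType) (c : seq T) (x : T) :
  uniq c -> 3 <= size c -> x \in c -> next c x != prev c x.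
Proof.
move=> uc sc xc; have [i s def_c] := rot_to xc.
rewrite -(next_rot i uc) -(prev_rot i uc).
have := uc; rewrite -(rot_uniq i) def_c; move: sc; rewrite -(size_rot i) def_c.
case: s {def_c} => [|y [|z s]] //= _ /andP[xyzs /andP[yzs _]]; rewrite eqxx.
move: xyzs; rewrite !inE !negb_or => /and3P[/negPf-> /negPf-> xs].
suff -> : prev_at x x z s = last z s.
  by apply: contra yzs => /eqP->; apply: mem_last.
elim: s z xs {yzs} => [|u s IHs] z /=; first by rewrite eqxx.
by rewrite inE negb_or => /andP[/negPf-> xs]; rewrite IHs.
Qed.

Lemma set2_eqP (T : finType) (a b x y : T) :
  [set a; b]%SET = [set x; y]%SET -> a = x /\ b = y \/ a = y /\ b = x.
Proof.
move=> E; have := set21 a b; have := set22 a b; have := set21 x y.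
have := set22 x y; rewrite -{1 2}E {3 4}E.
move=> /set2P y' /set2P x' /set2P b' /set2P a'.
by case: a' => ax; case: b' => bx; move: x' y'; rewrite ax bx;
  intuition congruence.
Qed.

Variables (T : finType) (G : graph T).

Lemma degree_gt0 (u : T) : 1 < #|T| -> 0 < degree G u.
Proof.
move=> T1; have [v vu] : exists v, v != u.
  have /card_gt0P[v] : 0 < #|[set~ u]%SET| by rewrite cardsC1; lia.
  by rewrite !inE => vu; exists v.
have /connectP[[|w p] /=] := adj_connected G u v.
  by move=> _ E; rewrite E eqxx in vu.
by move=> /andP[uw _] _; apply/card_gt0P; exists w; rewrite inE.
Qed.

Lemma degree_lt (u : T) : degree G u < #|T|.
Proof.
have: #|[set v | G u v]%SET| <= #|[set~ u]%SET|.
  apply/subset_leq_card/fintype.subsetP => v; rewrite !inE.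
  apply: contraL => /eqP ->.
  by rewrite adj_irrefl.
by rewrite cardsC1 /degree; have : 0 < #|T| by [apply/card_gt0P; exists u]; lia.
Qed.

Lemma degree_cycle (c : seq T) (u : T) :
  ucycle G c -> 3 <= size c -> u \in c -> 1 < degree G u.
Proof.
case/andP=> cG uc sc uinc; have np := next_neq_prev uc sc uinc.
rewrite /degree; have <- : #|[set next c u; prev c u]%SET| = 2.
  by rewrite cards2 np.
apply/subset_leq_card/fintype.subsetP => v; rewrite !inE => /orP[]/eqP->.
  exact: next_cycle.
by rewrite adj_sym; apply: prev_cycle.
Qed.

Lemma unicyclic_degree_gt1 :
  unicyclic G -> 3 <= #|[set u | 1 < degree G u]%SET|.
Proof.
move=> [_ [[c [Gc sc] _] _]]; have uc : uniq c by case/andP: Gc.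
apply: (leq_trans sc); rewrite -(card_uniqP uc).
apply/subset_leq_card/fintype.subsetP => u uinc; rewrite inE.
by apply: degree_cycle Gc sc uinc.
Qed.

(* [dep] is the distance to the root and [par] the parent in a BFS tree. *)
Lemma parent_function (r : T) :
  exists (dep : T -> nat) (par : T -> T),
    forall u, u != r -> G u (par u) /\ dep (par u) < dep u.
Proof.
pose P u k := `[< exists p, [/\ path G r p, last r p = u & size p = k] >].
have exP u : exists k, P u k.
  have /connectP[p Gp ->] := adj_connected G r u.
  by exists (size p); apply/asboolP; exists p.
pose dep u := ex_minn (exP u).
have parP u : exists v, u != r -> G u v /\ dep v < dep u.
  rewrite /dep; case: (ex_minnP (exP u)) => k /asboolP[p [Gp lp <-]] _.
  (* The parent is the penultimate vertex of a shortest path, and the truncated path [q] bounds its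
     depth. An empty path means that [u] is the root. *)
  case: (lastP p) Gp lp => [|q w]; first by move=> _ <-; exists r; rewrite eqxx.
  rewrite rcons_path last_rcons size_rcons => /andP[Gq Gw] <-.
  exists (last r q) => _; split; first by rewrite adj_sym.
  case: ex_minnP => m _ min_m; rewrite ltnS; apply: min_m.
  by apply/asboolP; exists q.
by have [par parE] := choice parP; exists dep, par.
Qed.

(** * Spanning tree of parents and the edge count *)

Section ParentTree.
Variables (r : T) (dep : T -> nat) (par : T -> T).
Hypothesis parP : forall u, u != r -> G u (par u) /\ dep (par u) < dep u.

Let tree (u v : T) := (u != r) && (v == par u) || (v != r) && (u == par v).

Let tree_sym : symmetric tree.
Proof. by move=> u v; rewrite /tree orbC. Qed.

Let tree_adj u v : tree u v -> G u v.
Proof.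
case/orP=> /andP[/parP[Gp _] /eqP ->] //.
by rewrite adj_sym.
Qed.

Let tree_connect u v : connect tree u v.
Proof.
suff root w : connect tree w r.
  apply: connect_trans (root u) _.
  by rewrite (sym_connect_sym tree_sym); apply: root.
have [m] := ubnP (dep w); elim: m w => // m IHm w wm.
have [->|wr] := eqVneq w r; first exact: connect0.
have [_ dw] := parP wr; apply: connect_trans (connect1 _) (IHm (par w) _).
  by rewrite /tree wr eqxx.
exact: leq_trans dw _.
Qed.

(* The two neighbours on a cycle of a vertex of maximal depth cannot both be
   its parent. *)
Let cycle_nontree (c : seq T) : ucycle G c -> 3 <= size c ->
  exists2 a, a \in c & ~~ tree a (next c a).
Proof.
move=> Gc sc; have uc : uniq c by case/andP: Gc.
apply/hasP; apply: contraT => /hasPn/= nct.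
have ct a : a \in c -> tree a (next c a) by move/nct; rewrite negbK.
have [m0 m0c] : exists x, x \in c.
  by case: (c) sc => // x s _; exists x; rewrite mem_head.
have [m mc max_m] : {m | m \in c & forall x, x \in c -> dep x <= dep m}.
  by case: (@arg_maxnP T m0 (mem c) dep m0c) => m; exists m.
have parm v : v \in c -> tree m v -> v = par m.
  move=> vc /orP[/andP[_ /eqP//]|/andP[/parP[_ dv] /eqP mE]].
  by have := max_m v vc; rewrite leqNgt mE dv.
have pc : prev c m \in c by rewrite mem_prev.
have nm : next c m = par m by apply: parm; rewrite ?mem_next ?ct.
have pm : prev c m = par m.
  by apply: parm; rewrite // tree_sym -[X in tree _ X](next_prev uc) ct.
by have := next_neq_prev uc sc mc; rewrite nm pm eqxx.
Qed.

(** The cycle is the tree path from [x] to [y], closed by the edge from [y] back to [x]. This is its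
    only non-tree edge, so the cycle determines the edge. *)
Let fundamental_cycle x y : G x y -> ~~ tree x y ->
  exists c, [/\ ucycle G c, 3 <= size c, [set x; y]%SET \in cycle_edges c &
    forall a b, [set a; b]%SET \in cycle_edges c -> ~~ tree a b ->
      [set a; b]%SET = [set x; y]%SET].
Proof.
move=> Gxy ntxy; have /connectP[p0 tp0 yE] := tree_connect x y.
case: (shortenP tp0) yE => p tp up _ yE {p0 tp0}.
have xy : x != y by apply: contraTneq Gxy => ->; rewrite adj_irrefl.
pose e u v := tree u v || (u == y) && (v == x).
have ce : cycle e (x :: p).
  rewrite /= rcons_path -yE /e !eqxx orbT andbT.
  by apply: sub_path tp => u v ->.
have edgeP z : z \in x :: p -> e z (next (x :: p) z) by apply: next_cycle.
have Gc : ucycle G (x :: p).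
  rewrite /ucycle up andbT; apply: sub_cycle ce => u v /orP[/tree_adj//|].
  by case/andP=> /eqP-> /eqP->; rewrite adj_sym.
have sc : 3 <= size (x :: p).
  (* An empty [p] would give [x = y], and a single vertex would make the edge from [x] to [y] a tree
     edge. *)
  case: (p) yE tp => [|z [|? ?]] //=; first by move=> yx; rewrite yx eqxx in xy.
  by move=> <-; rewrite andbT (negPf ntxy).
exists (x :: p); split=> //.
  (* Some step of the cycle leaves the tree, and only the closing one can. *)
  have [z zc ntz] := cycle_nontree Gc sc; apply/imsetP; exists z => //.
  have := edgeP z zc; rewrite /e (negPf ntz) /= => /andP[/eqP -> /eqP ->].
  by rewrite finset.setUC.
move=> a b /imsetP[z zc abE] ntab; case/orP: (edgeP z zc) => [tz|].
  by case: (set2_eqP abE) ntab => -[-> ->]; [rewrite tz | rewrite tree_sym tz].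
by case/andP=> /eqP zE /eqP nE; rewrite abE nE zE finset.setUC.
Qed.

(** Every fundamental cycle is the unique cycle, so there is a single non-tree edge, counted once in
    each direction. *)
Let nontree_card : unicyclic G ->
  #|[set e : T * T | G e.1 e.2 && ~~ tree e.1 e.2]%SET| = 2.
Proof.
case=> C [[c [Gc sc] CE] uniqC].
have [a ac nta] := cycle_nontree Gc sc; set b := next c a in nta.
have Gab : G a b by apply: next_cycle => //; case/andP: Gc.
have ab : a != b by apply: contraTneq Gab => <-; rewrite adj_irrefl.
rewrite -(_ : #|[set (a, b); (b, a)]%SET| = 2); last first.
  by rewrite cards2 xpair_eqE negb_and ab.
congr #|pred_of_set _|; apply/finset.setP => -[x y]; rewrite !inE !xpair_eqE /=.
apply/idP/idP => [/andP[Gxy ntxy]|].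
  have [c' [Gc' sc' xyc' c'P]] := fundamental_cycle Gxy ntxy.
  have C' : cycle_edges c' = C by apply/esym/uniqC; exists c'.
  have /c'P /(_ nta)/set2_eqP[] : [set a; b]%SET \in cycle_edges c'.
    by rewrite C' CE; apply/imsetP; exists a.
    by case=> -> ->; rewrite !eqxx.
  by case=> -> ->; rewrite !eqxx orbT.
by case/orP=> /andP[/eqP-> /eqP->]; rewrite ?Gab // adj_sym Gab tree_sym.
Qed.

(** Each non-root vertex gives one pair in [up] and one in [dn]. Depth decreases along the former
    and increases along the latter, so the two sets are disjoint. *)
Let tree_card : #|[set e : T * T | tree e.1 e.2]%SET| = 2 * (#|T| - 1).
Proof.
pose up := [set (u, par u) | u in [set~ r]]%SET.
pose dn := [set (par u, u) | u in [set~ r]]%SET.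
have -> : [set e : T * T | tree e.1 e.2]%SET = (up :|: dn)%SET.
  apply/finset.setP => -[u v]; rewrite !inE /=; apply/orP/orP.
    case=> /andP[ur /eqP ->]; [left | right]; apply/imsetP.
      by exists u; rewrite // !inE.
    by exists v; rewrite // !inE.
  case=> /imsetP[w]; rewrite !inE => wr [-> ->]; [left | right];
  by rewrite wr eqxx.
rewrite cardsU (_ : (up :&: dn)%SET = finset.set0) ?cards0.
  rewrite !card_in_imset ?cardsC1; first by lia.
    by move=> u v _ _ [].
  by move=> u v _ _ [].
apply/finset.setP => e; rewrite finset.in_setI finset.in_set0; apply/negP.
case/andP=> /imsetP[u]; rewrite !inE => /parP[_ du] ->.
case/imsetP=> v; rewrite !inE => /parP[_ dv] [uE vE].
by move: du dv; rewrite vE -uE; lia.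
Qed.

(** Degrees count ordered adjacent pairs: [2 * (#|T| - 1)] in the tree and 2 outside it. *)
Lemma unicyclic_sum_degree_of_parents :
  unicyclic G -> \sum_(u : T) degree G u = 2 * #|T|.
Proof.
move=> uG.
have -> : \sum_(u : T) degree G u = #|[set e : T * T | G e.1 e.2]%SET|.
  rewrite -sum1_card (eq_bigl (fun e : T * T => true && G e.1 e.2)); last first.
    by move=> e; rewrite inE.
  rewrite -(pair_big_dep xpredT (fun u v => G u v) (fun _ _ => 1)) /=.
  by apply: eq_bigr => u _; rewrite sum1_card /degree cardsE.
rewrite -(cardsID [set e : T * T | tree e.1 e.2]%SET).
rewrite (_ : (_ :&: _)%SET = [set e : T * T | tree e.1 e.2]%SET); last first.
  apply/finset.setP => e; rewrite !inE andbC; apply: andb_idr; exact: tree_adj.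
rewrite (_ : (_ :\: _)%SET =
  [set e : T * T | G e.1 e.2 && ~~ tree e.1 e.2]%SET); last first.
  by apply/finset.setP => e; rewrite !inE andbC.
rewrite tree_card nontree_card //.
by have : 0 < #|T| by [apply/card_gt0P; exists r]; lia.
Qed.

End ParentTree.

Lemma unicyclic_sum_degree :
  unicyclic G -> \sum_(u : T) degree G u = 2 * #|T|.
Proof.
move=> uG; have [r _] := adj_edge G.
have [dep [par parP]] := parent_function r.
exact: unicyclic_sum_degree_of_parents parP uG.
Qed.

End UnicyclicDegrees.

(** * Majorization *)

Section Majorization.

(** Truncated subtraction supplies the positive part; at [k = 0] this is the plain sum. *)
Definition hinge_sum (s : seq nat) (k : nat) : nat := (\sum_(x <- s) (x - k))%N.

Lemma hinge_sum_count (s : seq nat) (k : nat) :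
  hinge_sum s k = (hinge_sum s k.+1 + count (fun x => k < x) s)%N.
Proof.
rewrite /hinge_sum -sum1_count [X in (_ + X)%N]big_mkcond -big_split /=.
by apply: eq_bigr => x _; case: ltnP; lia.
Qed.

(** Consecutive hinge sums differ by the number of entries above [k], and consecutive such numbers
    differ by a multiplicity. Hinge sums do not see zeros, whose multiplicity comes from the
    size. *)
Lemma hinge_sum_perm (s t : seq nat) :
  size s = size t -> hinge_sum s =1 hinge_sum t -> perm_eq s t.
Proof.
move=> sz hst.
have cgt k : count (fun x => k < x)%N s = count (fun x => k < x)%N t.
  by have := hinge_sum_count s k; rewrite !hst hinge_sum_count; lia.
have cnt0 (u : seq nat) :
    (count_mem 0%N u + count (fun y => 0 < y) u)%N = size u.
  elim: u => //= y u IHu; lia.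
have cntS (u : seq nat) x :
    (count_mem x.+1 u + count (fun y => x.+1 < y) u)%N =
    count (fun y => x < y)%N u.
  by elim: u => //= y u IHu; lia.
apply/allP => -[|x] _ /=; apply/eqP.
  by have := cnt0 s; have := cnt0 t; rewrite cgt sz => <- /addIn.
by have := cntS s x; have := cntS t x; rewrite !cgt => <- /addIn.
Qed.

Variables (R : realType) (phi : nat -> R).

Let c (k : nat) : R := phi k.+2 + phi k - phi k.+1 *+ 2.

(* Discrete Taylor formula: [phi] is an affine function plus a combination of
   hinges [e |-> (e - k.+1)] weighted by its second differences. *)
Let hinge_decomposition (N e : nat) : (e <= N.+1)%N ->
  phi e = phi 0%N + (phi 1%N - phi 0%N) *+ e
          + \sum_(k < N) c k *+ (e - k.+1)%N.
Proof.
have incr n : phi n.+1 - phi n = phi 1%N - phi 0%N + \sum_(k < n) c k.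
  elim: n => [|n IHn]; first by rewrite big_ord0 addr0.
  by rewrite big_ord_recr /= addrA -IHn /c mulr2n; ring.
elim: e => [|e IHe] eN.
  by rewrite mulr0n addr0 big1 ?addr0 // => k _; rewrite sub0n mulr0n.
(* From [e] to [e.+1], exactly the hinges with [k < e] grow, each by one. *)
have -> : \sum_(k < N) c k *+ (e.+1 - k.+1)%N =
    \sum_(k < N) c k *+ (e - k.+1)%N + \sum_(k < e) c k.
  rewrite (big_ord_widen N c eN).
  rewrite [X in _ + X]big_mkcond -big_split /=; apply: eq_bigr => k _.
  case: ltnP => ke; first by rewrite -mulrSr; congr (_ *+ _); lia.
  by rewrite addr0; congr (_ *+ _); lia.
move: (incr e) (IHe (ltnW eN)) => /eqP; rewrite subr_eq => /eqP -> ->.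
by rewrite mulrSr; ring.
Qed.

(** For lists of equal size and equal sum, only the last term can differ. *)
Let sum_hinges (N : nat) (s : seq nat) : all (fun x => x <= N.+1)%N s ->
  \sum_(x <- s) phi x = phi 0%N *+ size s
    + (phi 1%N - phi 0%N) *+ hinge_sum s 0
    + \sum_(k < N) c k *+ hinge_sum s k.+1.
Proof.
move=> /allP sN.
rewrite (eq_big_seq _ (fun x xs => hinge_decomposition (sN x xs))).
rewrite !big_split /=; congr (_ + _ + _).
- by rewrite big_const_seq count_predT iter_addr_0.
- rewrite /hinge_sum -sumrMnr; apply: eq_bigr => x _; by rewrite subn0.
- rewrite exchange_big /=; apply: eq_bigr => k _.
  by rewrite /hinge_sum sumrMnr.
Qed.

Variables (s t : seq nat).
Hypothesis size_st : size s = size t.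
Hypothesis hinge0_st : hinge_sum s 0 = hinge_sum t 0.
Hypothesis hinge_st : forall k, (hinge_sum s k <= hinge_sum t k)%N.

Let N := \max_(x <- s ++ t) x.

Let st_le : all (fun x => x <= N.+1)%N s /\ all (fun x => x <= N.+1)%N t.
Proof.
by split; apply/allP => x xst; apply: leqW; apply: leq_bigmax_seq => //;
  rewrite mem_cat xst ?orbT.
Qed.

Lemma majorization_le :
  (forall k, phi k.+1 *+ 2 <= phi k.+2 + phi k) ->
  \sum_(x <- s) phi x <= \sum_(x <- t) phi x.
Proof.
move=> cvx; have [sN tN] := st_le.
rewrite (sum_hinges sN) (sum_hinges tN) size_st hinge0_st lerD2l.
apply: ler_sum => k _; apply: ler_wpMn2l; last exact: hinge_st.
by rewrite subr_ge0.
Qed.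

Lemma majorization_eq :
  (forall k, phi k.+1 *+ 2 < phi k.+2 + phi k) ->
  \sum_(x <- s) phi x = \sum_(x <- t) phi x -> perm_eq s t.
Proof.
move=> cvx; have [sN tN] := st_le.
rewrite (sum_hinges sN) (sum_hinges tN) size_st hinge0_st => /addrI E.
apply: hinge_sum_perm => // -[|k]; first exact: hinge0_st.
(* The decomposition stops at threshold [N]; beyond it no entry is large enough to contribute to
   either hinge sum. *)
have [kN|Nk] := ltnP k N; last first.
  have hinge0 u : all (fun x => x <= N.+1)%N u -> hinge_sum u k.+1 = 0%N.
    by move=> /allP uN; rewrite /hinge_sum big1_seq // => x /andP[_ /uN]; lia.
  by rewrite !hinge0.
have cpos m : 0 < c m by rewrite subr_gt0.
have E0 : \sum_(m < N) c m *+ (hinge_sum t m.+1 - hinge_sum s m.+1)%N = 0.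
  under eq_bigr do rewrite mulrnBr //.
  by rewrite sumrB E subrr.
have c_ge0 m n : 0 <= c m *+ n by apply/mulrn_wge0/ltW.
have /(_ (Ordinal kN) isT)/eqP := psumr_eq0P (fun m _ => c_ge0 (val m) _) E0.
rewrite mulrn_eq0 (gt_eqF (cpos _)) orbF /= subn_eq0 => ts.
by apply/eqP; rewrite eqn_leq ts hinge_st.
Qed.
End Majorization.

(** * The extremal sequence *)

Section ExtremalSequence.
Local Open Scope nat_scope.

Variables (n Delta : nat).
Hypothesis Delta_itv : 3 <= Delta < n.
Let q := n %/ (Delta - 1).

Let n_div : q * (Delta - 1) <= n < q * (Delta - 1) + (Delta - 1).
Proof.
have := ltn_pmod n (_ : 0 < Delta - 1); have := divn_eq n (Delta - 1).
by rewrite -/q; lia.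
Qed.

Let q_gt0 : 0 < q.
Proof. by rewrite divn_gt0; lia. Qed.

Let n_small : (q == 1) || (n == 2 * Delta - 2) -> n <= 2 * Delta - 2.
Proof. by case/orP=> /eqP H; move: n_div; rewrite ?H; lia. Qed.

Lemma size_zseq : size (zseq n Delta) = n.
Proof.
rewrite /zseq -/q; case: ifP => _; first by rewrite /= size_nseq; lia.
by rewrite size_cat /= !size_nseq; move: n_div; nia.
Qed.

Lemma zseq_gt0 : all (leq 1) (zseq n Delta).
Proof.
rewrite /zseq -/q; case: ifP => _.
  by rewrite /= all_nseq orbT andbT; lia.
by rewrite all_cat /= !all_nseq addn1 !orbT !andbT; lia.
Qed.

Lemma sorted_zseq : sorted geq (zseq n Delta).
Proof.
have ones m a : 0 < a -> path geq a (nseq m 1).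
  by elim: m a => //= m IHm a a0; rewrite IHm // andbT.
rewrite /zseq -/q; case: ifP => [/n_small small|_].
  by rewrite /= ones //; lia.
apply: (@path_sorted _ _ Delta).
suff : path geq Delta (n - q * (Delta - 1) + 1 :: nseq (n - q - 1) 1).
  by elim: (X in nseq X Delta) => //= m IHm /IHm ->; rewrite leqnn.
by rewrite /= ones; move: n_div; lia.
Qed.

Lemma hinge_sum_zseq k :
  hinge_sum (map predn (zseq n Delta)) k =
  if (q == 1) || (n == 2 * Delta - 2)
  then (Delta - 1 - k) + (n - Delta - k) + (1 - k)
  else q * (Delta - 1 - k) + (n - q * (Delta - 1) - k).
Proof.
have hinge_nseq m x : \sum_(y <- nseq m x) (y - k) = m * (x - k).
  by rewrite big_nseq iter_addn_0 mulnC.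
rewrite /hinge_sum /zseq -/q; case: ifP => _.
  by rewrite /= map_nseq !big_cons hinge_nseq; clear -Delta_itv; lia.
rewrite map_cat /= big_cat big_cons /= !map_nseq !hinge_nseq.
by rewrite !subn1 addn1 muln0 addn0.
Qed.

(** Here [s] stands for the degrees lowered by one. Two bounds in terms of the number [m] of entries
    above [k] are played against each other: [le_few] for small [m], [le_many] for large [m]. *)
Lemma zseq_majorizes (s : seq nat) :
  hinge_sum s 0 = n -> all (fun x => x <= Delta - 1) s ->
  3 <= count (leq 1) s ->
  hinge_sum s 0 = hinge_sum (map predn (zseq n Delta)) 0 /\
  forall k, hinge_sum s k <= hinge_sum (map predn (zseq n Delta)) k.
Proof.
move=> s0 sD s3.
have E0 : hinge_sum s 0 = hinge_sum (map predn (zseq n Delta)) 0.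
  by rewrite s0 hinge_sum_zseq; case: ifP => _; move: n_div; lia.
split=> // k; case: (posnP k) => [->|k0]; first by rewrite E0.
pose m := count (fun x => k < x) s.
have le_few : hinge_sum s k <= m * (Delta - 1 - k).
  rewrite /m /hinge_sum; elim: s sD {m s0 s3 E0} => [|x s IHs] /=.
    by rewrite big_nil.
  by case/andP=> xD /IHs; rewrite big_cons; case: ltnP; nia.
(* Of the total [n], each entry above [k] spends [k] outside the hinge sum, and each other positive
   entry spends at least 1. *)
have le_many : hinge_sum s k + k * m + count (leq 1) s <= n + m.
  rewrite -s0 /m /hinge_sum; elim: s {m sD s0 s3 E0 le_few} => [|x s IHs] /=.
    by rewrite !big_nil; lia.
  by rewrite !big_cons; move: IHs; case: (ltnP k x); case: (ltnP 0 x); nia.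
have m_le : m <= count (leq 1) s.
  by apply: sub_count => x /=; apply: leq_ltn_trans.
rewrite hinge_sum_zseq; case: ifP => [/n_small small|_].
  have [m3|m2] := leqP 3 m; first by nia.
  have [m1|m1] := leqP m 1; first by nia.
  (* The third positive entry is decisive here: it improves the bound [n - 2 * k] to
     [n - 2 * k - 1], which the hinge sum of [zseq] dominates. *)
  have m2' : m = 2 by lia.
  by move: le_many; rewrite m2'; lia.
have [kD|Dk] := leqP k (Delta - 1); last by nia.
(* Up to [q] entries above [k] are matched by the [q] entries [Delta] of [zseq]; with more of them,
   [le_many] leaves at most [n - k * q.+1]. *)
have [mq|qm] := leqP m q.
  apply: leq_trans le_few (leq_trans _ (leq_addr _ _)).
  by rewrite leq_mul2r mq orbT.
have qD : q * (Delta - 1) = q * (Delta - 1 - k) + q * k.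
  by rewrite -mulnDr; congr (_ * _); lia.
have qk : k * q + k <= k * m by rewrite -mulnSr leq_mul2l qm orbT.
move: n_div; rewrite qD; lia.
Qed.

End ExtremalSequence.

(** * Products of log-convex functions *)

Section LogConvexProducts.
Variables (R : realType) (f : R -> R).
Hypothesis f_gt0 : forall x : R, 1 <= x -> 0 < f x.

(** The shift matches degrees lowered by one and keeps the argument of [f] in its domain. *)
Let phi (k : nat) : R := ln (f k.+1%:R).

Let half_ge0 : 0 <= 2^-1 :> R. Proof. by rewrite invr_ge0. Qed.

Let half_le1 : 2^-1 <= 1 :> R. Proof. by rewrite invf_le1 // ler1n. Qed.

Let half : {i01 R} := Itv01 half_ge0 half_le1.

Let conv_half (a b : R^o) : conv half a b = (a + b) / 2 :> R^o.
Proof.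
rewrite convRE /= /unstable.onem.
by change (2^-1 * a + (1 - 2^-1) * b = (a + b) / 2 :> R); field.
Qed.

Let midpoint (k : nat) : conv half (k.+3%:R : R^o) k.+1%:R = k.+2%:R :> R^o.
Proof.
rewrite conv_half; change ((k.+3%:R + k.+1%:R) / 2 = k.+2%:R :> R).
by rewrite -![in RHS]natr1 -!natr1; field.
Qed.

Let ge1 (k : nat) : (k.+1%:R : R^o) \in (`[1, +oo[%classic : set R).
Proof. by rewrite inE /= in_itv /= andbT ler1n. Qed.

(** Convexity with weight 1/2 suffices, as [k.+2] is the midpoint of [k.+1] and [k.+3]. *)
Lemma log_convex_nat : log_convex f ->
  forall k, phi k.+1 *+ 2 <= phi k.+2 + phi k.
Proof.
move=> hf k; have := hf half _ _ (ge1 k.+2) (ge1 k).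
rewrite [X in f X](midpoint k : _ = _).
rewrite [X in _ <= X](conv_half (phi k.+2) (phi k)) //.
rewrite -/(phi k.+1) -/(phi k.+2) -/(phi k).
by rewrite ler_pdivlMr // mulr_natr.
Qed.

Lemma strictly_log_convex_nat : strictly_log_convex f ->
  forall k, phi k.+1 *+ 2 < phi k.+2 + phi k.
Proof.
move=> hf k.
have half01 : 0 < half%:num < 1 by rewrite /= invr_gt0 ltr0n invf_lt1 ?ltr1n.
have neq : (k.+3%:R : R) != k.+1%:R by rewrite eqr_nat; lia.
have := hf half half01 _ _ (ge1 k.+2) (ge1 k) neq.
rewrite [X in f X](midpoint k : _ = _).
rewrite [X in _ < X](conv_half (phi k.+2) (phi k)).
by rewrite -/(phi k.+1) ltr_pdivlMr // mulr_natr.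
Qed.

(** Logarithms turn products over degrees into the sums that majorization compares; [predn]
    compensates the shift in [phi]. *)
Lemma prod_expR_ln (s : seq nat) : all (leq 1) s ->
  \prod_(x <- s) f x%:R = expR (\sum_(x <- map predn s) phi x).
Proof.
move=> /allP s1; rewrite expR_sum big_map; apply: eq_big_seq => x /s1 x1.
by rewrite /phi prednK // lnK // posrE f_gt0 // ler1n.
Qed.
End LogConvexProducts.

(** * Degree sequences and the bounds on [II] *)

Section DegreeSequence.
Variables (R : realType) (T : finType) (G : graph T).

Lemma degree_sequence_perm :
  perm_eq (degree_sequence G) [seq degree G u | u <- enum T].
Proof. by rewrite perm_sort. Qed.

Lemma size_degree_sequence : size (degree_sequence G) = #|T|.
Proof. by rewrite size_sort size_map cardE. Qed.

Lemma count_degree_sequence (P : pred nat) :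
  count P (degree_sequence G) = #|[set u | P (degree G u)]%SET|.
Proof.
rewrite (permP degree_sequence_perm) count_map -sum1_count big_enum_cond /=.
by rewrite sum1dep_card.
Qed.

Lemma all_degree_sequence (P : pred nat) :
  all P (degree_sequence G) = [forall u, P (degree G u)].
Proof.
rewrite (perm_all _ degree_sequence_perm) all_map.
apply/allP/forallP => [H u|H u _ /=]; last exact: H.
by have /= := H u; rewrite mem_enum; apply.
Qed.

Lemma II_degree_sequence (f : R -> R) :
  II G f = \prod_(x <- degree_sequence G) f x%:R.
Proof. by rewrite (perm_big _ degree_sequence_perm) big_map big_enum. Qed.

Lemma sum_degree_sequence :
  (\sum_(x <- degree_sequence G) x = \sum_u degree G u)%N.
Proof. by rewrite (perm_big _ degree_sequence_perm) big_map big_enum. Qed.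

End DegreeSequence.

(** Keeping the bound as a product over [zseq] treats both cases of the theorem at once. *)
Lemma II_le_zseq (R : realType) (T : finType) (G : graph T) (f : R -> R)
    (n Delta : nat) :
  unicyclic G -> #|T| = n -> max_degree G = Delta -> (3 <= Delta)%N ->
  (forall x : R, 1 <= x -> 0 < f x) -> log_convex f ->
  let B := \prod_(x <- zseq n Delta) f x%:R in
  [/\ II G f <= B,
      in_K n Delta G -> II G f = B
    & strictly_log_convex f -> (II G f = B <-> in_K n Delta G)].
Proof.
move=> uG nE DE D3 f_gt0 hf B.
have [r _] := adj_edge G.
have DG u : (degree G u <= Delta)%N by rewrite -DE; apply: leq_bigmax.
have Dn : (3 <= Delta < n)%N.
  rewrite D3 -nE -DE /max_degree /=.
  have T0 : (0 < #|T|)%N by apply/card_gt0P; exists r.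
  by have [u ->] := bigop.eq_bigmax (degree G) T0; apply: degree_lt.
set s := degree_sequence G; set s' := map predn s.
set z' := map predn (zseq n Delta).
have s1 : all (leq 1) s.
  by rewrite all_degree_sequence; apply/forallP => u; apply: degree_gt0; lia.
have z1 := zseq_gt0 Dn.
have sz : size s' = size z'.
  by rewrite !size_map size_degree_sequence size_zseq.
(* Lowering each of the [n] degrees by one turns the sum [2 * n] into [n]. *)
have sum_s' : hinge_sum s' 0 = n.
  have := sum_degree_sequence G; rewrite unicyclic_sum_degree // nE -/s.
  have -> : (\sum_(x <- s) x = hinge_sum s' 0 + size s)%N.
    rewrite /hinge_sum big_map -sum1_size -big_split; apply: eq_big_seq => x.
    by move=> /(allP s1); rewrite /=; lia.
  by rewrite size_degree_sequence nE; lia.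
have s'D : all (fun x => x <= Delta - 1)%N s'.
  rewrite all_map all_degree_sequence; apply/forallP => u /=.
  by have := DG u; lia.
have s'3 : (3 <= count (leq 1) s')%N.
  rewrite count_map (eq_count (a2 := leq 2)); last by case.
  by rewrite count_degree_sequence unicyclic_degree_gt1.
have [h0 hk] := zseq_majorizes Dn sum_s' s'D s'3.
have IIE : II G f = expR (\sum_(x <- s') ln (f x.+1%:R)).
  by rewrite II_degree_sequence prod_expR_ln.
have BE : B = expR (\sum_(x <- z') ln (f x.+1%:R)) by rewrite /B prod_expR_ln.
have KE : in_K n Delta G -> II G f = B.
  by case=> _ _ E; rewrite II_degree_sequence E.
split=> //.
  rewrite IIE BE ler_expR; apply: (majorization_le sz h0 hk).
  exact: log_convex_nat.
move=> hsf; split=> // E; split=> //.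
(* Equal products have equal logarithms, so strict majorization gives a permutation of the lowered
   lists. Adding one back permutes the original lists, which are both sorted and hence equal. *)
have /(perm_map succn) : perm_eq s' z'.
  apply: (majorization_eq sz h0 hk (strictly_log_convex_nat hsf)).
  by apply: expR_inj; rewrite -IIE -BE.
have predK u : all (leq 1) u -> map succn (map predn u) = u.
  by move=> /allP u1; rewrite -map_comp map_id_in // => x /u1 /= /prednK.
rewrite !predK //; apply: sorted_eq (sorted_zseq Dn).
- by move=> x y w /= xy yw; apply: leq_trans yw xy.
- by move=> x y /= /andP[xy yx]; apply/eqP; rewrite eqn_leq yx.
- by apply: sort_sorted => x y; apply: leq_total.
Qed.

Theorem theorem4p8 (R : realType) (T : finType) (G : graph T)
    (n Delta q : nat) (f : R -> R)
    (hG : unicyclic G)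
    (hn : #|T| = n) (hn4 : (4 <= n)%N)
    (hD : max_degree G = Delta) (hD3 : (3 <= Delta)%N)
    (hq : q = (n %/ (Delta - 1))%N)
    (hfpos : forall x : R, 1 <= x -> 0 < f x)
    (hf : log_convex f) :
  (q = 1%N \/ n = (2 * Delta - 2)%N ->
     let B := f Delta%:R * f (n - Delta + 1)%N%:R * f 2 * f 1 ^+ (n - 3) in
     [/\ II G f <= B,
         in_K n Delta G -> II G f = B
       & strictly_log_convex f -> (II G f = B <-> in_K n Delta G)]) /\
  ((1 < q)%N /\ n <> (2 * Delta - 2)%N ->
     let B := f Delta%:R ^+ q * f (n - q * (Delta - 1) + 1)%N%:R
              * f 1 ^+ (n - q - 1) in
     [/\ II G f <= B,
         in_K n Delta G -> II G f = B
       & strictly_log_convex f -> (II G f = B <-> in_K n Delta G)]).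
Proof.
split.
  move=> q1 B.
  have zE : (q == 1%N) || (n == 2 * Delta - 2)%N.
    by case: q1 => ->; rewrite eqxx ?orbT.
  move: (II_le_zseq hG hn hD hD3 hfpos hf).
  (* Expanding the product over [zseq] gives the stated bound, its block of ones becoming a power of
     [f 1]. *)
  rewrite /zseq -hq zE !big_cons big_nseq iter_mulr_1 !mulrA; exact.
move=> [q2 nD] B.
have zE : (q == 1%N) || (n == 2 * Delta - 2)%N = false by lia.
move: (II_le_zseq hG hn hD hD3 hfpos hf).
rewrite /zseq -hq zE big_cat big_cons !big_nseq !iter_mulr_1 /= mulrA; exact.
Qed.
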